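(* There exists no Pythagorean triangle which is a $T_2(k,4,d)$. That is, there are no integers $k\geq 2$ and $d$ with $2\leq d\leq 3$ such that some Pythagorean triangle has one leg of length $d^k$ and the other leg of length $d_{k,4}=\dfrac{d\,(4^k-1)}{3}$.
   Context: A Pythagorean triangle is a right triangle all of whose side lengths are positive integers. For integers $b\geq 3$, $2\leq d\leq b-1$ and $k\geq 2$, $d_{k,b}=d\,(b^{k-1}+\cdots+b+1)=\dfrac{d(b^k-1)}{b-1}$ denotes the positive integer whose base $b$ representation consists of $k$ digits all equal to $d$. A Pythagorean triangle is a Type 2 triangle with base $b$ repeated digits, denoted $T_2(k,b,d)$ (with $b\geq 3$, $2\leq d\leq b-1$, $k\geq 2$), if one of its legs has length $d^k$ and the other leg has length $d_{k,b}$. *)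

(* Defs.v *)
From mathcomp Require Import all_boot.

Set Implicit Arguments.
Unset Strict Implicit.
Unset Printing Implicit Defensive.

(* Legs x and y, hypotenuse z. *)
Definition pythagorean_triangle (x y z : nat) : Prop :=
  [/\ 0 < x, 0 < y, 0 < z & x ^ 2 + y ^ 2 = z ^ 2].

(* The number whose base-b representation is k digits all equal to d
   (for 0 < d < b). *)
Definition repdigit (k b d : nat) : nat := d * \sum_(i < k) b ^ i.

Lemma repdigitE (k b d : nat) :
  1 < b -> repdigit k b d = (d * (b ^ k - 1)) %/ (b - 1).
Proof.
move=> b_gt1; rewrite /repdigit !subn1 predn_exp mulnCA mulKn //.
by case: b b_gt1 => [|[]].
Qed.

(* The two legs play symmetric roles, so both assignments are allowed. *)
Definition type2_triangle (k b d x y z : nat) : Prop :=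
  [/\ 3 <= b, 2 <= d <= b - 1, 2 <= k,
      pythagorean_triangle x y z &
      (x = d ^ k /\ y = repdigit k b d) \/ (x = repdigit k b d /\ y = d ^ k)].

(* Main.v *)
Require Import Defs.
From mathcomp Require Import all_boot zify.

(** The digit [d] is 2 or 3, and each case has a short obstruction.

    For [d = 3] both legs are odd: a power of 3, and 3 times
    [1 + 4 + ... + 4^(k-1)].  The sum of two odd squares is 2 modulo 4,
    so it is not a square ([odd_legs_not_pythagorean]).

    For [d = 2] the obstruction is one of size.  The squares next to [y ^ 2]
    are far apart, so the square of the other leg must exceed [2 * y]
    ([pythagorean_leg_gap]).  Here that square is [4 ^ k], while twice the
    repdigit leg is [4 * (1 + 4 + ... + 4^(k-1))], whose leading term alone is
    already [4 ^ k]. *)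

(** The hypotenuse is at least [y + 1], so [x ^ 2 >= (y + 1) ^ 2 - y ^ 2]. *)
Lemma pythagorean_leg_gap (x y z : nat) :
  0 < x -> x ^ 2 + y ^ 2 = z ^ 2 -> 2 * y < x ^ 2.
Proof.
move=> x_gt0 xyz.
have lt_yz : y < z by rewrite -ltn_sqr -xyz -[ltnLHS]add0n ltn_add2r expn_gt0 x_gt0.
have : y.+1 ^ 2 <= z ^ 2 by rewrite leq_sqr.
by rewrite -xyz -addn1 sqrnD; lia.
Qed.

(** Writing [x = 2 m + 1], [y = 2 n + 1], the hypotenuse is even, and its
    square is then both 2 and 0 modulo 4. *)
Lemma odd_legs_not_pythagorean (x y z : nat) :
  odd x -> odd y -> x ^ 2 + y ^ 2 <> z ^ 2.
Proof.
move=> x_odd y_odd xyz.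
have /negbTE z_even : ~~ odd z.
  by move: (congr1 odd xyz); rewrite oddD !oddX x_odd y_odd /= => <-.
move: xyz.
rewrite -(odd_double_half x) -(odd_double_half y) -(odd_double_half z).
rewrite x_odd y_odd z_even -!mul2n; nia.
Qed.

Lemma odd_repunit (k b : nat) : ~~ odd b -> odd (\sum_(i < k.+1) b ^ i).
Proof.
move=> b_even; rewrite big_ord_recl expn0 oddD /=.
apply: (big_ind (fun n => ~~ odd n)) => [//|m n|i _]; first by rewrite oddD; case: odd.
by rewrite oddX (negbTE b_even).
Qed.

Lemma leq_repunit (k b : nat) : b ^ k <= \sum_(i < k.+1) b ^ i.
Proof. by rewrite big_ord_recr /= leq_addl. Qed.

Theorem theorem1 (k d : nat) :
  ~ exists x y z : nat, type2_triangle k 4 d x y z.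
Proof.
case=> [x [y [z [_ d_bounds k_ge2 [x_gt0 y_gt0 _ xyz] legs]]]].
have {x y x_gt0 y_gt0 legs}xyz : (d ^ k) ^ 2 + repdigit k 4 d ^ 2 = z ^ 2.
  by case: legs xyz => -[-> ->] //; rewrite addnC.
case: k k_ge2 xyz => // k _; rewrite /repdigit => xyz.
have [d2 | d3] : d = 2 \/ d = 3 by lia.
- rewrite {}d2 in xyz.
  have := pythagorean_leg_gap _ _ _ _ xyz; rewrite expn_gt0 => /(_ isT).
  by rewrite expnAC -[2 ^ 2]/4 expnS; have := leq_repunit k 4; lia.
- rewrite {}d3 in xyz; apply: odd_legs_not_pythagorean xyz.
  + by rewrite oddX orbT.
  + by rewrite oddM odd_repunit.
Qed.
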